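(* Let $(\mathcal J,E)$ be a marked 2-category, $\mathcal C$ a 2-category, $F\colon\mathcal J\to\mathcal C$ a 2-functor, $p\colon\mathcal C^{/F}_E\to\mathcal C$ the projection from the 2-category of $E$-lax cones over $F$, and $(\ell,\lambda)$ an object of $\mathcal C^{/F}_E$. Let $M_{\mathrm{cart}}$ be the class of $p$-cartesian 1-cells of $\mathcal C^{/F}_E$. Then $\mathcal C^{/F}_E$ admits a limiting contraction with center $(\ell,\lambda)$ if and only if every object $(\ell',\lambda')$ of $\mathcal C^{/F}_E$ admits a $p$-cartesian 1-cell $(\ell',\lambda')\to(\ell,\lambda)$ and the 2-functor $\{(\ell,\lambda)\}\to(\mathcal C^{/F}_E,M_{\mathrm{cart}})$ is final.
   Context: Conventions. 2-categories and 2-functors are strict. Composition of 1-cells and whiskering are written by juxtaposition; $\beta\circ\alpha$ is vertical composition of 2-cells (first $\alpha$, then $\beta$). $\mathcal C(x,y)$ is the hom-category. A marked 2-category $(\mathcal J,E)$ is a 2-category $\mathcal J$ with a class $E$ of 1-cells containing all identities; a marked 2-functor preserves marked 1-cells. $E$-lax cones. An $E$-lax cone $(x,\alpha)$ over $F\colon\mathcal J\to\mathcal C$ is an object $x$ of $\mathcal C$, 1-cells $\alpha_i\colon x\to Fi$ for each object $i$, and 2-cells $\alpha_k\colon F(k)\alpha_i\to\alpha_j$ for each 1-cell $k\colon i\to j$ of $\mathcal J$, such that $\alpha_{1_i}=1_{\alpha_i}$; $\alpha_{hk}=\alpha_h\circ(F(h)\alpha_k)$; $\alpha_k=\alpha_{k'}\circ(F(\Lambda)\alpha_i)$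 for each 2-cell $\Lambda\colon k\to k'$; and $\alpha_k$ is invertible for $k\in E$. 2-category of cones $\mathcal C^{/F}_E$. Objects: $E$-lax cones $(x,\alpha)$ over $F$. 1-cells $(x,\alpha)\to(y,\beta)$: pairs $(f,\mu)$ with $f\colon x\to y$ and 2-cells $\mu_i\colon\beta_i f\to\alpha_i$ such that $\alpha_k\circ(F(k)\mu_i)=\mu_j\circ(\beta_k f)$ for all $k\colon i\to j$. 2-cells $(f,\mu)\to(g,\delta)$: 2-cells $\Xi\colon f\to g$ of $\mathcal C$ with $\delta_i\circ(\beta_i\Xi)=\mu_i$ for all $i$. Composition of 1-cells: $(g,\nu)(f,\mu)=(gf,\ (\mu_i\circ(\nu_i f))_i)$; the rest is inherited from $\mathcal C$. The projection $p\colon\mathcal C^{/F}_E\to\mathcal C$ is $(x,\alpha)\mapsto x$, $(f,\mu)\mapsto f$, $\Xi\mapsto\Xi$. Cartesian 1-cells. For a 2-functor $p\colon\mathcal E\to\mathcal B$, a 1-cell $f\colon x\to y$ of $\mathcal E$ is $p$-cartesian if for every object $a$ the square with $f\circ-\colon\mathcal E(a,x)\to\mathcal E(a,y)$ over $p(f)\circ-\colon\mathcal B(pa,px)\to\mathcal B(pa,py)$ is a (strict) pullback of categories. Contractions. A contraction on a 2-category $\mathcal D$ with center $c$ consists of 1-cells $\gamma_x\colon x\to c$ for all objects $x$ and 2-cells $\gamma_f\colon\gamma_y f\to\gamma_x$ for all 1-cells $f\colon x\to y$, such that $\gamma_{1_x}=1_{\gamma_x}$; $\gamma_{gf}=\gamma_f\circ(\gamma_g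 f)$; $\gamma_f=\gamma_g\circ(\gamma_y\alpha)$ for every 2-cell $\alpha\colon f\to g\colon x\to y$; $\gamma_c=1_c$; and $\gamma_{\gamma_x}=1_{\gamma_x}$ for all $x$. For a marking $M$ of $\mathcal D$, an $M$-contraction is a contraction with every $\gamma_x$ in $M$ and $\gamma_f$ invertible for every $f\in M$. A limiting contraction on $\mathcal C^{/F}_E$ is an $M_{\mathrm{cart}}$-contraction. Final 2-functors. For a marked 2-category $(\mathcal D,M)$, a 2-functor $G\colon\mathcal D\to\mathcal E$ and an object $d$ of $\mathcal E$, let $\mathrm{Cocone}_M(G,d)$ be the category whose objects $\rho$ consist of 1-cells $\rho_x\colon Gx\to d$ and 2-cells $\rho_f\colon\rho_y G(f)\to\rho_x$ for $f\colon x\to y$, with $\rho_{1_x}=1_{\rho_x}$, $\rho_{gf}=\rho_f\circ(\rho_g G(f))$, $\rho_f=\rho_g\circ(\rho_y G(\alpha))$ for each 2-cell $\alpha\colon f\to g\colon x\to y$, and $\rho_f$ invertible for $f\in M$; morphisms $\rho\to\rho'$ are families of 2-cells $m_x\colon\rho_x\to\rho'_x$ with $m_x\circ\rho_f=\rho'_f\circ(m_y G(f))$. A marked 2-functor $u\colon(\mathcal A,M_{\mathcal A})\to(\mathcal D,M)$ is final if for every 2-category $\mathcal E$, 2-functor $G\colon\mathcal D\to\mathcal E$ and object $d$ of $\mathcal E$, the restriction functor $\mathrm{Cocone}_M(G,d)\to\mathrm{Cocone}_{M_{\mathcal A}}(Gu,d)$ is an equivalence of categories. Here $\{(\ell,\lambda)\}$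 denotes the terminal 2-category with its identity marked, so that $\mathrm{Cocone}(Gu,d)=\mathcal E(G(\ell,\lambda),d)$ and restriction is evaluation at $(\ell,\lambda)$. *)

(* Defs.v *)
From Stdlib Require Import FunctionalExtensionality ProofIrrelevance.

Set Implicit Arguments.
Unset Strict Implicit.
Unset Printing Implicit Defensive.

Declare Scope twocat_scope.
Delimit Scope twocat_scope with twocat.
Local Open Scope twocat_scope.

Reserved Notation "a ~> b" (at level 70, no associativity).
Reserved Notation "g ∘ f" (at level 45, left associativity).
Reserved Notation "f ~= g" (at level 70, no associativity).
Reserved Notation "g @ f" (at level 30, right associativity).
Reserved Notation "g <| b" (at level 35, right associativity).
Reserved Notation "b |> f" (at level 35, right associativity).

Record category := Category {
  obj :> Type;
  arr : obj -> obj -> Type;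
  idc : forall a, arr a a;
  vcomp : forall a b c, arr b c -> arr a b -> arr a c;
  vcomp_1l : forall a b (f : arr a b), vcomp (idc b) f = f;
  vcomp_1r : forall a b (f : arr a b), vcomp f (idc a) = f;
  vcomp_assoc : forall a b c d (h : arr c d) (g : arr b c) (f : arr a b),
    vcomp (vcomp h g) f = vcomp h (vcomp g f)
}.

Arguments arr {_} _ _.
Arguments idc {_} _.
Notation "a ~> b" := (arr a b) : twocat_scope.
Notation "g ∘ f" := (vcomp g f) : twocat_scope.

(** Equality of arrows of a category: [f ~= g] says that [f] and [g] have the
    same source, the same target, and are equal.  The two sides of an equation
    between 2-cells of a strict 2-category often have sources (or targets) that
    are only propositionally equal, e.g. [(h @ g) @ f] and [h @ (g @ f)]. *)
Inductive arr_eq (A : category) (a b : A) (f : a ~> b) :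
    forall a' b' : A, (a' ~> b') -> Prop :=
  arr_eq_refl : arr_eq f f.

Notation "f ~= g" := (arr_eq f g) : twocat_scope.

Definition cast_src (A : category) (a a' b : A) (e : a = a') (f : a ~> b) :
    a' ~> b :=
  match e in _ = s return s ~> b with eq_refl => f end.

Definition invertible (A : category) (a b : A) (f : a ~> b) : Prop :=
  exists g : b ~> a, g ∘ f = idc a /\ f ∘ g = idc b.

Record functor (A B : category) := Functor {
  fobj :> A -> B;
  farr : forall a b : A, (a ~> b) -> (fobj a ~> fobj b);
  farr_id : forall a : A, farr (idc a) = idc (fobj a);
  farr_comp : forall (a b c : A) (g : b ~> c) (f : a ~> b),
    farr (g ∘ f) = farr g ∘ farr f
}.

Arguments farr {A B} f {a b} _ : rename.

Definition functor_id (A : category) : functor A A :=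
  @Functor A A (fun a => a) (fun _ _ f => f)
    (fun _ => eq_refl) (fun _ _ _ _ _ => eq_refl).

Definition functor_comp (A B C : category) (G : functor B C) (F : functor A B) :
    functor A C.
Proof.
refine (@Functor A C (fun a => G (F a)) (fun _ _ f => farr G (farr F f)) _ _).
- intros a; now rewrite !farr_id.
- intros a b c g f; now rewrite !farr_comp.
Defined.

Definition nat_iso (A B : category) (F G : functor A B) : Prop :=
  exists t : forall a : A, F a ~> G a,
    (forall (a b : A) (f : a ~> b), farr G f ∘ t a = t b ∘ farr F f) /\
    (forall a : A, invertible (t a)).

Definition is_equivalence (A B : category) (F : functor A B) : Prop :=
  exists G : functor B A,
    nat_iso (functor_comp G F) (functor_id A) /\
    nat_iso (functor_comp F G) (functor_id B).

(** The square with [F], [G] out of [P] and [H], [K] into [X] is a pullback in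
    the 1-category of categories and functors; equality of functors is strict. *)
Definition is_pullback (P A B X : category) (F : functor P A) (G : functor P B)
    (H : functor A X) (K : functor B X) : Prop :=
  functor_comp H F = functor_comp K G /\
  forall (Q : category) (u : functor Q A) (v : functor Q B),
    functor_comp H u = functor_comp K v ->
    exists! w : functor Q P, functor_comp F w = u /\ functor_comp G w = v.

Section ArrEq.
Variable A : category.

Lemma arr_eq_src (a b a' b' : A) (f : a ~> b) (f' : a' ~> b') : f ~= f' -> a = a'.
Proof. now destruct 1. Qed.

Lemma arr_eq_tgt (a b a' b' : A) (f : a ~> b) (f' : a' ~> b') : f ~= f' -> b = b'.
Proof. now destruct 1. Qed.

Lemma arr_eq_sigT (a b a' b' : A) (f : a ~> b) (f' : a' ~> b') :
  f ~= f' ->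
  existT (fun a => {b : A & a ~> b}) a (existT (fun b => a ~> b) b f) =
  existT (fun a => {b : A & a ~> b}) a' (existT (fun b => a' ~> b) b' f').
Proof. now destruct 1. Qed.

Lemma arr_eq_eq (a b : A) (f g : a ~> b) : f ~= g -> f = g.
Proof.
intros e; apply arr_eq_sigT in e.
now apply inj_pair2, inj_pair2 in e.
Qed.

Lemma eq_arr_eq (a b : A) (f g : a ~> b) : f = g -> f ~= g.
Proof. intros ->; constructor. Qed.

Lemma arr_eq_sym (a b a' b' : A) (f : a ~> b) (f' : a' ~> b') : f ~= f' -> f' ~= f.
Proof. now destruct 1. Qed.

Lemma arr_eq_trans (a b a' b' a'' b'' : A)
    (f : a ~> b) (f' : a' ~> b') (f'' : a'' ~> b'') :
  f ~= f' -> f' ~= f'' -> f ~= f''.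
Proof. now destruct 1. Qed.

Lemma arr_eq_id (a a' : A) : a = a' -> idc a ~= idc a'.
Proof. intros ->; constructor. Qed.

Lemma arr_eq_vcomp (a b c a' b' c' : A) (g : b ~> c) (f : a ~> b)
    (g' : b' ~> c') (f' : a' ~> b') :
  g ~= g' -> f ~= f' -> g ∘ f ~= g' ∘ f'.
Proof.
intros eg ef.
destruct (arr_eq_src ef), (arr_eq_src eg), (arr_eq_tgt eg).
now rewrite (arr_eq_eq eg), (arr_eq_eq ef).
Qed.

Lemma cast_src_eq (a a' b : A) (e : a = a') (f : a ~> b) : cast_src e f ~= f.
Proof. now destruct e. Qed.

End ArrEq.

Lemma arr_eq_farr (A B : category) (F : functor A B) (a b a' b' : A)
    (f : a ~> b) (f' : a' ~> b') :
  f ~= f' -> farr F f ~= farr F f'.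
Proof. now destruct 1. Qed.

Lemma functor_eq (A B : category) (F G : functor A B) :
  (forall (a b : A) (f : a ~> b), farr F f ~= farr G f) -> F = G.
Proof.
destruct F as [F0 F1 Fi Fc], G as [G0 G1 Gi Gc]; simpl; intros e.
assert (e0 : F0 = G0).
{ extensionality a; exact (arr_eq_src (e a a (idc a))). }
subst G0.
assert (e1 : F1 = G1).
{ extensionality a; extensionality b; extensionality f.
  exact (arr_eq_eq (e a b f)). }
subst G1; f_equal; apply proof_irrelevance.
Qed.

Record twocat := TwoCat {
  ob :> Type;
  hom : ob -> ob -> category;
  id1 : forall x, hom x x;
  comp1 : forall x y z, hom y z -> hom x y -> hom x z;
  hcomp : forall x y z (g g' : hom y z) (f f' : hom x y),
    (g ~> g') -> (f ~> f') -> (comp1 g f ~> comp1 g' f');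
  comp1_1l : forall x y (f : hom x y), comp1 (id1 y) f = f;
  comp1_1r : forall x y (f : hom x y), comp1 f (id1 x) = f;
  comp1_assoc : forall x y z w (h : hom z w) (g : hom y z) (f : hom x y),
    comp1 (comp1 h g) f = comp1 h (comp1 g f);
  hcomp_id : forall x y z (g : hom y z) (f : hom x y),
    hcomp (idc g) (idc f) = idc (comp1 g f);
  hcomp_vcomp : forall x y z (g g' g'' : hom y z) (f f' f'' : hom x y)
      (b' : g' ~> g'') (b : g ~> g') (a' : f' ~> f'') (a : f ~> f'),
    hcomp (b' ∘ b) (a' ∘ a) = hcomp b' a' ∘ hcomp b a;
  hcomp_1l : forall x y (f f' : hom x y) (a : f ~> f'),
    hcomp (idc (id1 y)) a ~= a;
  hcomp_1r : forall x y (f f' : hom x y) (a : f ~> f'),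
    hcomp a (idc (id1 x)) ~= a;
  hcomp_assoc : forall x y z w (h h' : hom z w) (g g' : hom y z) (f f' : hom x y)
      (c : h ~> h') (b : g ~> g') (a : f ~> f'),
    hcomp (hcomp c b) a ~= hcomp c (hcomp b a)
}.

Arguments hom {_} _ _.
Arguments id1 {_} _.

Notation "g @ f" := (comp1 g f) : twocat_scope.
Notation "g <| b" := (hcomp (idc g) b) : twocat_scope.
Notation "b |> f" := (hcomp b (idc f)) : twocat_scope.

Record twofunctor (C D : twocat) := TwoFunctor {
  tob :> C -> D;
  thom : forall x y : C, functor (hom x y) (hom (tob x) (tob y));
  thom_id1 : forall x : C, thom x x (id1 x) = id1 (tob x);
  thom_comp1 : forall (x y z : C) (g : hom y z) (f : hom x y),
    thom x z (g @ f) = thom y z g @ thom x y f;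
  thom_hcomp : forall (x y z : C) (g g' : hom y z) (f f' : hom x y)
      (b : g ~> g') (a : f ~> f'),
    farr (thom x z) (hcomp b a) ~= hcomp (farr (thom y z) b) (farr (thom x y) a)
}.

Definition map1 (C D : twocat) (F : twofunctor C D) (x y : C) (f : hom x y) :
    hom (F x) (F y) := thom F x y f.

Definition map2 (C D : twocat) (F : twofunctor C D) (x y : C) (f g : hom x y)
    (a : f ~> g) : map1 F f ~> map1 F g := farr (thom F x y) a.

Definition twofunctor_comp (B C D : twocat) (G : twofunctor C D)
    (F : twofunctor B C) : twofunctor B D.
Proof.
refine (@TwoFunctor B D (fun x => G (F x))
  (fun x y => functor_comp (thom G (F x) (F y)) (thom F x y)) _ _ _).
- intros x; simpl; now rewrite !thom_id1.
- intros x y z g f; simpl; now rewrite !thom_comp1.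
- intros x y z g g' f f' b a; simpl.
  eapply arr_eq_trans; [apply arr_eq_farr, thom_hcomp | apply thom_hcomp].
Defined.

Section Hcomp.
Variable C : twocat.

Lemma arr_eq_hcomp (x y z : C) (g1 g2 g1' g2' : hom y z) (f1 f2 f1' f2' : hom x y)
    (b : g1 ~> g2) (a : f1 ~> f2) (b' : g1' ~> g2') (a' : f1' ~> f2') :
  b ~= b' -> a ~= a' -> hcomp b a ~= hcomp b' a'.
Proof. now destruct 1, 1. Qed.

Lemma whiskl_vcomp (x y z : C) (g : hom y z) (f f' f'' : hom x y)
    (a' : f' ~> f'') (a : f ~> f') :
  g <| (a' ∘ a) = (g <| a') ∘ (g <| a).
Proof. now rewrite <- hcomp_vcomp, vcomp_1l. Qed.

Lemma whiskr_vcomp (x y z : C) (f : hom x y) (g g' g'' : hom y z)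
    (b' : g' ~> g'') (b : g ~> g') :
  (b' ∘ b) |> f = (b' |> f) ∘ (b |> f).
Proof. now rewrite <- hcomp_vcomp, vcomp_1l. Qed.

Lemma whisk_exchange (x y z : C) (g g' : hom y z) (f f' : hom x y)
    (b : g ~> g') (a : f ~> f') :
  (b |> f') ∘ (g <| a) = (g' <| a) ∘ (b |> f).
Proof. now rewrite <- !hcomp_vcomp, !vcomp_1l, !vcomp_1r. Qed.

End Hcomp.

Record marked_twocat := MarkedTwoCat {
  under :> twocat;
  marked : forall x y : under, hom x y -> Prop;
  marked_id1 : forall x : under, marked (id1 x)
}.

Arguments marked m [x y] f : rename.

Record marked_twofunctor (A D : marked_twocat) := MarkedTwoFunctor {
  under_functor :> twofunctor A D;
  preserves_marked : forall (x y : A) (f : hom x y),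
    marked A f -> marked D (map1 under_functor f)
}.

Definition postcomp (C : twocat) (a x y : C) (f : hom x y) :
    functor (hom a x) (hom a y).
Proof.
refine (@Functor (hom a x) (hom a y) (fun h => f @ h) (fun h h' s => f <| s) _ _).
- intros h; apply hcomp_id.
- intros h h' h'' t s; apply whiskl_vcomp.
Defined.

Definition cartesian (D B : twocat) (p : twofunctor D B) (x y : D) (f : hom x y) :
    Prop :=
  forall a : D,
    is_pullback (postcomp a f) (thom p a x) (thom p a y)
      (postcomp (p a) (map1 p f)).

Lemma postcomp_id1 (C : twocat) (a x : C) : postcomp a (id1 x) = functor_id (hom a x).
Proof. apply functor_eq; intros f g s; apply hcomp_1l. Qed.

Lemma functor_comp_1l (A B : category) (F : functor A B) :
  functor_comp (functor_id B) F = F.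
Proof. apply functor_eq; intros; constructor. Qed.

Lemma functor_comp_1r (A B : category) (F : functor A B) :
  functor_comp F (functor_id A) = F.
Proof. apply functor_eq; intros; constructor. Qed.

Lemma cartesian_id1 (D B : twocat) (p : twofunctor D B) (x : D) :
  cartesian p (id1 x).
Proof.
intros a; unfold map1; rewrite thom_id1, !postcomp_id1; split.
- now rewrite functor_comp_1l, functor_comp_1r.
- intros Q u v e; rewrite functor_comp_1l in e; exists u; split.
  + now rewrite functor_comp_1l.
  + intros w [ew _]; now rewrite functor_comp_1l in ew.
Qed.

Definition cartesian_marking (D B : twocat) (p : twofunctor D B) : marked_twocat :=
  @MarkedTwoCat D (fun x y f => cartesian p f) (cartesian_id1 p).

(** In [ctr2_ctr1], [ctr2 (ctr1 x)] is a 2-cell from [ctr1 c @ ctr1 x], which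
    equals [ctr1 x] by [ctr1_center]. *)
Record contraction (D : twocat) (c : D) := Contraction {
  ctr1 : forall x : D, hom x c;
  ctr2 : forall (x y : D) (f : hom x y), ctr1 y @ f ~> ctr1 x;
  ctr2_id1 : forall x : D, ctr2 (id1 x) ~= idc (ctr1 x);
  ctr2_comp1 : forall (x y z : D) (g : hom y z) (f : hom x y),
    ctr2 (g @ f) ~= ctr2 f ∘ (ctr2 g |> f);
  ctr2_cell : forall (x y : D) (f g : hom x y) (a : f ~> g),
    ctr2 f = ctr2 g ∘ (ctr1 y <| a);
  ctr1_center : ctr1 c = id1 c;
  ctr2_ctr1 : forall x : D, ctr2 (ctr1 x) ~= idc (ctr1 x)
}.

Definition marked_contraction (D : marked_twocat) (c : D) (t : contraction c) :
    Prop :=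
  (forall x : D, marked D (ctr1 t x)) /\
  (forall (x y : D) (f : hom x y), marked D f -> invertible (ctr2 t f)).

Section Cocone.
Variables (D : marked_twocat) (E : twocat) (G : twofunctor D E) (d : E).

Record cocone := Cocone {
  coc1 : forall x : D, hom (G x) d;
  coc2 : forall (x y : D) (f : hom x y), coc1 y @ map1 G f ~> coc1 x;
  coc2_id1 : forall x : D, coc2 (id1 x) ~= idc (coc1 x);
  coc2_comp1 : forall (x y z : D) (g : hom y z) (f : hom x y),
    coc2 (g @ f) ~= coc2 f ∘ (coc2 g |> map1 G f);
  coc2_cell : forall (x y : D) (f g : hom x y) (a : f ~> g),
    coc2 f = coc2 g ∘ (coc1 y <| map2 G a);
  coc2_marked : forall (x y : D) (f : hom x y), marked D f -> invertible (coc2 f)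
}.

Lemma coc2_ext (r : cocone) (x y : D) (f g : hom x y) :
  f = g -> coc2 r f ~= coc2 r g.
Proof. intros ->; constructor. Qed.

Record cocone_mor (r r' : cocone) := CoconeMor {
  cocm :> forall x : D, coc1 r x ~> coc1 r' x;
  cocm_nat : forall (x y : D) (f : hom x y),
    cocm x ∘ coc2 r f = coc2 r' f ∘ (cocm y |> map1 G f)
}.

Lemma cocone_mor_eq (r r' : cocone) (m n : cocone_mor r r') :
  (forall x, m x = n x) -> m = n.
Proof.
destruct m as [m mn], n as [n nn]; simpl; intros e.
assert (e' : m = n) by now extensionality x.
subst n; f_equal; apply proof_irrelevance.
Qed.

Definition cocone_mor_id (r : cocone) : cocone_mor r r.
Proof.
exists (fun x => idc (coc1 r x)).
intros x y f; now rewrite hcomp_id, vcomp_1l, vcomp_1r.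
Defined.

Definition cocone_mor_comp (r r' r'' : cocone) (n : cocone_mor r' r'')
    (m : cocone_mor r r') : cocone_mor r r''.
Proof.
exists (fun x => n x ∘ m x).
intros x y f.
now rewrite whiskr_vcomp, vcomp_assoc, cocm_nat, <- !vcomp_assoc, cocm_nat.
Defined.

Definition cocone_cat : category.
Proof.
refine (@Category cocone cocone_mor cocone_mor_id cocone_mor_comp _ _ _);
  intros; apply cocone_mor_eq; intros x; simpl.
- apply vcomp_1l.
- apply vcomp_1r.
- apply vcomp_assoc.
Defined.

End Cocone.

Section Restriction.
Variables (A D : marked_twocat) (u : marked_twofunctor A D).
Variables (E : twocat) (G : twofunctor D E) (d : E).

Definition restrict_cocone (r : cocone G d) :
    cocone (D := A) (twofunctor_comp G u) d.
Proof.
refine (@Cocone A E (twofunctor_comp G u) d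
  (fun a => coc1 r (u a)) (fun a b f => coc2 r (map1 u f)) _ _ _ _).
- intros x; apply arr_eq_trans with (f' := coc2 r (id1 (u x))); [|exact (coc2_id1 r (u x))].
  exact (coc2_ext r (thom_id1 u x)).
- intros x y z g f.
  apply arr_eq_trans with (f' := coc2 r (map1 u g @ map1 u f)); [|exact (coc2_comp1 r (map1 u g) (map1 u f))].
  exact (coc2_ext r (thom_comp1 u g f)).
- intros x y f g a; apply (coc2_cell r (map2 u a)).
- intros x y f mf; exact (coc2_marked r (preserves_marked u mf)).
Defined.

Definition restrict_cocone_mor (r r' : cocone G d) (m : cocone_mor r r') :
    cocone_mor (restrict_cocone r) (restrict_cocone r').
Proof.
exists (fun a => m (u a)).
intros x y f; exact (cocm_nat m (map1 u f)).
Defined.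

Definition restriction :
  functor (cocone_cat G d) (cocone_cat (D := A) (twofunctor_comp G u) d).
Proof.
refine (@Functor (cocone_cat G d) (cocone_cat (D := A) (twofunctor_comp G u) d)
  restrict_cocone restrict_cocone_mor _ _).
- intros r; now apply cocone_mor_eq.
- intros r r' r'' n m; now apply cocone_mor_eq.
Defined.

End Restriction.

Definition final (A D : marked_twocat) (u : marked_twofunctor A D) : Prop :=
  forall (E : twocat) (G : twofunctor D E) (d : E),
    is_equivalence (restriction u G d).

Definition terminal_category : category.
Proof.
refine (@Category unit (fun _ _ => unit) (fun _ => tt) (fun _ _ _ _ _ => tt) _ _ _).
- now intros a b [].
- now intros a b [].
- reflexivity.
Defined.

Definition terminal_twocat : twocat.
Proof.
refine (@TwoCat unit (fun _ _ => terminal_category) (fun _ => tt)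
  (fun _ _ _ _ _ => tt) (fun _ _ _ _ _ _ _ _ _ => tt) _ _ _ _ _ _ _ _).
- now intros x y [].
- now intros x y [].
- reflexivity.
- reflexivity.
- reflexivity.
- intros x y [] [] []; constructor.
- intros x y [] [] []; constructor.
- intros; constructor.
Defined.

Definition terminal_marked : marked_twocat :=
  @MarkedTwoCat terminal_twocat (fun x y (f : hom x y) => f = tt)
    (fun _ => eq_refl).

Definition const_functor (A B : category) (b : B) : functor A B.
Proof.
refine (@Functor A B (fun _ => b) (fun _ _ _ => idc b) _ _).
- reflexivity.
- intros; now rewrite vcomp_1l.
Defined.

Definition point_twofunctor (D : twocat) (d : D) : twofunctor terminal_twocat D.
Proof.
refine (@TwoFunctor terminal_twocat D (fun _ => d)
  (fun _ _ => const_functor terminal_category (id1 d)) _ _ _).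
- reflexivity.
- intros; simpl; now rewrite comp1_1l.
- intros; simpl; apply arr_eq_sym, hcomp_1l.
Defined.

Definition point (D : marked_twocat) (d : D) : marked_twofunctor terminal_marked D :=
  @MarkedTwoFunctor terminal_marked D (point_twofunctor d)
    (fun _ _ _ _ => marked_id1 d).

Section Cones.
Variables (J : marked_twocat) (C : twocat) (F : twofunctor J C).

Record lax_cone := LaxCone {
  apex : C;
  leg1 : forall i : J, hom apex (F i);
  leg2 : forall (i j : J) (k : hom i j), map1 F k @ leg1 i ~> leg1 j;
  leg2_id1 : forall i : J, leg2 (id1 i) ~= idc (leg1 i);
  leg2_comp1 : forall (i j l : J) (h : hom j l) (k : hom i j),
    leg2 (h @ k) ~= leg2 h ∘ (map1 F h <| leg2 k);
  leg2_cell : forall (i j : J) (k k' : hom i j) (L : k ~> k'),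
    leg2 k = leg2 k' ∘ (map2 F L |> leg1 i);
  leg2_marked : forall (i j : J) (k : hom i j), marked J k -> invertible (leg2 k)
}.

Record cone1 (X Y : lax_cone) := Cone1 {
  c1_map : hom (apex X) (apex Y);
  c1_cell : forall i : J, leg1 Y i @ c1_map ~> leg1 X i;
  c1_nat : forall (i j : J) (k : hom i j),
    leg2 X k ∘ (map1 F k <| c1_cell i) ~= c1_cell j ∘ (leg2 Y k |> c1_map)
}.

Record cone2 (X Y : lax_cone) (f g : cone1 X Y) := Cone2 {
  c2_cell : c1_map f ~> c1_map g;
  c2_eq : forall i : J, c1_cell g i ∘ (leg1 Y i <| c2_cell) = c1_cell f i
}.

Lemma cone1_eq (X Y : lax_cone) (f g : cone1 X Y) :
  c1_map f = c1_map g -> (forall i, c1_cell f i ~= c1_cell g i) -> f = g.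
Proof.
destruct f as [f m fn], g as [g n gn]; simpl; intros e; subst g; intros e.
assert (e' : m = n) by (extensionality i; exact (arr_eq_eq (e i))).
subst n; f_equal; apply proof_irrelevance.
Qed.

Lemma cone2_eq (X Y : lax_cone) (f g : cone1 X Y) (s t : cone2 f g) :
  c2_cell s = c2_cell t -> s = t.
Proof.
destruct s as [s es], t as [t et]; simpl; intros e; subst t.
f_equal; apply proof_irrelevance.
Qed.

Definition cone2_id (X Y : lax_cone) (f : cone1 X Y) : cone2 f f.
Proof.
exists (idc (c1_map f)).
intros i; now rewrite hcomp_id, vcomp_1r.
Defined.

Definition cone2_vcomp (X Y : lax_cone) (f g h : cone1 X Y)
    (t : cone2 g h) (s : cone2 f g) : cone2 f h.
Proof.
exists (c2_cell t ∘ c2_cell s).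
intros i; now rewrite whiskl_vcomp, <- vcomp_assoc, !c2_eq.
Defined.

Definition cone_hom (X Y : lax_cone) : category.
Proof.
refine (@Category (cone1 X Y) (@cone2 X Y) (@cone2_id X Y) (@cone2_vcomp X Y) _ _ _);
  intros; apply cone2_eq; simpl.
- apply vcomp_1l.
- apply vcomp_1r.
- apply vcomp_assoc.
Defined.

Lemma cone2_arr_eq (X Y : lax_cone) (f g f' g' : cone_hom X Y)
    (s : f ~> g) (s' : f' ~> g') :
  f = f' -> g = g' -> c2_cell s ~= c2_cell s' -> s ~= s'.
Proof.
intros ef eg; subst f' g'; intros e.
now apply eq_arr_eq, cone2_eq, arr_eq_eq.
Qed.

Definition cone1_id (X : lax_cone) : cone1 X X.
Proof.
refine (@Cone1 X X (id1 (apex X))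
  (fun i => cast_src (eq_sym (comp1_1r (leg1 X i))) (idc (leg1 X i))) _).
intros i j k.
apply arr_eq_trans with (f' := leg2 X k).
- eapply arr_eq_trans.
  + apply arr_eq_vcomp; [constructor|].
    apply arr_eq_hcomp; [constructor|]; apply cast_src_eq.
  + rewrite hcomp_id, vcomp_1r; constructor.
- apply arr_eq_sym; eapply arr_eq_trans.
  + apply arr_eq_vcomp; [apply cast_src_eq | apply hcomp_1r].
  + rewrite vcomp_1l; constructor.
Defined.

(** The family of 2-cells of a composite is [m_i ∘ (n_i |> f)]; only its source
    has to be rebracketed. *)
Definition cone1_comp (X Y Z : lax_cone) (g : cone1 Y Z) (f : cone1 X Y) :
    cone1 X Z.
Proof.
refine (@Cone1 X Z (c1_map g @ c1_map f)
  (fun i => cast_src (comp1_assoc (leg1 Z i) (c1_map g) (c1_map f))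
              (c1_cell f i ∘ (c1_cell g i |> c1_map f))) _).
intros i j k.
apply arr_eq_trans with
  (f' := leg2 X k ∘ (map1 F k <| (c1_cell f i ∘ (c1_cell g i |> c1_map f)))).
{ apply arr_eq_vcomp; [constructor|].
  apply arr_eq_hcomp; [constructor|]; apply cast_src_eq. }
rewrite whiskl_vcomp, <- vcomp_assoc.
apply arr_eq_trans with
  (f' := c1_cell f j ∘ (leg2 Y k |> c1_map f)
     ∘ ((map1 F k <| c1_cell g i) |> c1_map f)).
{ apply arr_eq_vcomp; [apply c1_nat | apply arr_eq_sym, hcomp_assoc]. }
rewrite vcomp_assoc, <- whiskr_vcomp.
apply arr_eq_trans with
  (f' := c1_cell f j ∘ ((c1_cell g j ∘ (leg2 Z k |> c1_map g)) |> c1_map f)).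
{ apply arr_eq_vcomp; [constructor|].
  apply arr_eq_hcomp; [apply c1_nat | constructor]. }
rewrite whiskr_vcomp, <- vcomp_assoc.
apply arr_eq_vcomp; [apply arr_eq_sym, cast_src_eq|].
rewrite <- hcomp_id; apply hcomp_assoc.
Defined.

Definition cone2_hcomp (X Y Z : lax_cone) (g g' : cone1 Y Z) (f f' : cone1 X Y)
    (t : cone2 g g') (s : cone2 f f') :
  cone2 (cone1_comp g f) (cone1_comp g' f').
Proof.
exists (hcomp (c2_cell t) (c2_cell s)).
intros i; simpl; apply arr_eq_eq.
apply arr_eq_trans with
  (f' := c1_cell f' i ∘ (c1_cell g' i |> c1_map f')
     ∘ hcomp (leg1 Z i <| c2_cell t) (c2_cell s)).
{ apply arr_eq_vcomp; [apply cast_src_eq | apply arr_eq_sym, hcomp_assoc]. }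
rewrite vcomp_assoc, <- hcomp_vcomp, vcomp_1l, c2_eq.
apply arr_eq_trans with (f' := c1_cell f i ∘ (c1_cell g i |> c1_map f));
  [| apply arr_eq_sym, cast_src_eq].
rewrite <- (c2_eq s i), vcomp_assoc, <- hcomp_vcomp, vcomp_1l, vcomp_1r.
constructor.
Defined.

Lemma cone1_comp_1l (X Y : lax_cone) (f : cone1 X Y) :
  cone1_comp (cone1_id Y) f = f.
Proof.
apply cone1_eq; simpl; [apply comp1_1l|]; intros i.
eapply arr_eq_trans; [apply cast_src_eq|].
eapply arr_eq_trans.
- apply arr_eq_vcomp; [constructor|].
  apply arr_eq_hcomp; [apply cast_src_eq | constructor].
- rewrite hcomp_id, vcomp_1r; constructor.
Qed.

Lemma cone1_comp_1r (X Y : lax_cone) (f : cone1 X Y) :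
  cone1_comp f (cone1_id X) = f.
Proof.
apply cone1_eq; simpl; [apply comp1_1r|]; intros i.
eapply arr_eq_trans; [apply cast_src_eq|].
eapply arr_eq_trans.
- apply arr_eq_vcomp; [apply cast_src_eq | apply hcomp_1r].
- rewrite vcomp_1l; constructor.
Qed.

Lemma cone1_comp_assoc (X Y Z W : lax_cone)
    (h : cone1 Z W) (g : cone1 Y Z) (f : cone1 X Y) :
  cone1_comp (cone1_comp h g) f = cone1_comp h (cone1_comp g f).
Proof.
apply cone1_eq; simpl; [apply comp1_assoc|]; intros i.
eapply arr_eq_trans; [apply cast_src_eq|].
eapply arr_eq_trans.
{ apply arr_eq_vcomp; [constructor|].
  apply arr_eq_hcomp; [apply cast_src_eq | constructor]. }
rewrite whiskr_vcomp, <- vcomp_assoc.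
apply arr_eq_sym; eapply arr_eq_trans; [apply cast_src_eq|].
apply arr_eq_vcomp; [apply cast_src_eq|].
rewrite <- hcomp_id; apply arr_eq_sym, hcomp_assoc.
Qed.

Definition cone_twocat : twocat.
Proof.
refine (@TwoCat lax_cone cone_hom cone1_id cone1_comp cone2_hcomp
  cone1_comp_1l cone1_comp_1r cone1_comp_assoc _ _ _ _ _).
- intros x y z g f; apply cone2_eq, hcomp_id.
- intros x y z g g' g'' f f' f'' b' b a' a; apply cone2_eq, hcomp_vcomp.
- intros x y f f' a; apply cone2_arr_eq;
    [apply cone1_comp_1l | apply cone1_comp_1l | apply hcomp_1l].
- intros x y f f' a; apply cone2_arr_eq;
    [apply cone1_comp_1r | apply cone1_comp_1r | apply hcomp_1r].
- intros x y z w h h' g g' f f' c b a; apply cone2_arr_eq;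
    [apply cone1_comp_assoc | apply cone1_comp_assoc | apply hcomp_assoc].
Defined.

Definition cone_proj_hom (X Y : cone_twocat) :
  functor (hom X Y) (hom (apex X) (apex Y)) :=
  @Functor (hom X Y) (hom (apex X) (apex Y)) (@c1_map X Y) (@c2_cell X Y)
    (fun _ => eq_refl) (fun _ _ _ _ _ => eq_refl).

Definition cone_proj : twofunctor cone_twocat C :=
  @TwoFunctor cone_twocat C apex cone_proj_hom
    (fun _ => eq_refl) (fun _ _ _ _ _ => eq_refl)
    (fun _ _ _ _ _ _ _ _ _ => arr_eq_refl _).

Definition cone_cart : marked_twocat := cartesian_marking cone_proj.

Definition limiting_contraction (l : cone_twocat) (t : contraction l) : Prop :=
  marked_contraction (D := cone_cart) t.

End Cones.

(* Main.v *)
From Stdlib Require Import ProofIrrelevance ClassicalEpsilon.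
Require Import Defs.

(** The equivalence holds for any marked 2-category [D] and object [c] in place
    of [C^{/F}_E] with its cartesian marking.

    Given a marked contraction [γ], a quasi-inverse to evaluation at [c] sends
    [r : G c -> d] to the cocone [(r G(γ_x), r G(γ_f))]; the 2-cells [ρ_{γ_x}]
    compare [ρ] with the cocone so obtained from [ρ_c], and they are invertible
    because [γ_x] is marked.

    Conversely, apply finality to [G = id] and [d = c]: the identity of [c] lifts
    to a cocone [ρ] with an isomorphism [θ : 1_c -> ρ_c].  Choose marked
    [f_x : x -> c] with [f_c = 1_c] and transport [ρ] along the isomorphisms
    [σ_x = ρ_{f_x} ∘ (θ f_x) : f_x -> ρ_x].  The result is a contraction: since
    [σ_c = θ], its value at [f_x] is [σ_x^{-1} ∘ ρ_{f_x} ∘ (θ f_x) = 1]. *)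

Set Implicit Arguments.
Unset Strict Implicit.
Unset Printing Implicit Defensive.

Local Open Scope twocat_scope.

(** * Invertible 2-cells, whiskering, and identities up to [~=] *)

Lemma invertible_idc (A : category) (a : A) : invertible (idc a).
Proof. exists (idc a); split; apply vcomp_1l. Qed.

Lemma invertible_vcomp (A : category) (a b c : A) (g : b ~> c) (f : a ~> b) :
  invertible g -> invertible f -> invertible (g ∘ f).
Proof.
intros [g' [g'g gg']] [f' [f'f ff']]; exists (f' ∘ g'); split.
- now rewrite vcomp_assoc, <- (vcomp_assoc g'), g'g, vcomp_1l.
- now rewrite vcomp_assoc, <- (vcomp_assoc f), ff', vcomp_1l.
Qed.

Lemma invertible_inverse (A : category) (a b : A) (f : a ~> b) (g : b ~> a) :
  g ∘ f = idc a -> f ∘ g = idc b -> invertible g.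
Proof. now intros gf fg; exists f. Qed.

Lemma invertible_farr (A B : category) (F : functor A B) (a b : A) (f : a ~> b) :
  invertible f -> invertible (farr F f).
Proof.
intros [g [gf fg]]; exists (farr F g).
now rewrite <- !farr_comp, gf, fg, !farr_id.
Qed.

Lemma invertible_arr_eq (A : category) (a b a' b' : A) (f : a ~> b) (f' : a' ~> b') :
  f ~= f' -> invertible f -> invertible f'.
Proof. now destruct 1. Qed.

Lemma invertible_cast_src (A : category) (a a' b : A) (e : a = a') (f : a ~> b) :
  invertible f -> invertible (cast_src e f).
Proof. now apply invertible_arr_eq, arr_eq_sym, cast_src_eq. Qed.

Lemma invertible_whiskl (C : twocat) (x y z : C) (g : hom y z) (f f' : hom x y)
    (a : f ~> f') :
  invertible a -> invertible (g <| a).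
Proof. exact (@invertible_farr _ _ (postcomp x g) f f' a). Qed.

Lemma invertible_whiskr (C : twocat) (x y z : C) (g g' : hom y z) (f : hom x y)
    (b : g ~> g') :
  invertible b -> invertible (b |> f).
Proof.
intros [b' [b'b bb']]; exists (b' |> f).
now rewrite <- !whiskr_vcomp, b'b, bb', !hcomp_id.
Qed.

(** The relation [g ~= idc c] forces [b] and [b'] to equal [c], so the unit law applies after
    substitution. This cancels cells that are identities only after rebracketing a source or
    target. *)
Lemma arr_eq_vcomp_1l (A : category) (a b b' c : A) (g : b ~> b') (f : a ~> b) :
  g ~= idc c -> g ∘ f ~= f.
Proof.
intros e; pose proof (arr_eq_src e) as e1; pose proof (arr_eq_tgt e) as e2.
subst b b'; apply arr_eq_eq in e; subst g; rewrite vcomp_1l; constructor.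
Qed.

Lemma arr_eq_vcomp_1r (A : category) (a a' b c : A) (g : a' ~> b) (f : a ~> a') :
  f ~= idc c -> g ∘ f ~= g.
Proof.
intros e; pose proof (arr_eq_src e) as e1; pose proof (arr_eq_tgt e) as e2.
subst a a'; apply arr_eq_eq in e; subst f; rewrite vcomp_1r; constructor.
Qed.

Lemma map2_vcomp (C D : twocat) (F : twofunctor C D) (x y : C) (f g h : hom x y)
    (b : g ~> h) (a : f ~> g) :
  map2 F (b ∘ a) = map2 F b ∘ map2 F a.
Proof. apply farr_comp. Qed.

Lemma map2_whiskl (C D : twocat) (F : twofunctor C D) (x y z : C)
    (g : hom y z) (f f' : hom x y) (a : f ~> f') :
  map2 F (g <| a) ~= map1 F g <| map2 F a.
Proof.
eapply arr_eq_trans; [apply thom_hcomp|]; rewrite farr_id; constructor.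
Qed.

Lemma map2_whiskr (C D : twocat) (F : twofunctor C D) (x y z : C)
    (g g' : hom y z) (f : hom x y) (b : g ~> g') :
  map2 F (b |> f) ~= map2 F b |> map1 F f.
Proof.
eapply arr_eq_trans; [apply thom_hcomp|]; rewrite farr_id; constructor.
Qed.

Lemma whiskl_assoc (C : twocat) (x y z w : C) (h : hom z w) (g : hom y z)
    (f f' : hom x y) (a : f ~> f') :
  (h @ g) <| a ~= h <| (g <| a).
Proof. rewrite <- hcomp_id; apply hcomp_assoc. Qed.

Lemma whiskr_assoc (C : twocat) (x y z w : C) (h h' : hom z w) (g : hom y z)
    (f : hom x y) (b : h ~> h') :
  (b |> g) |> f ~= b |> (g @ f).
Proof. rewrite <- hcomp_id; apply hcomp_assoc. Qed.

Definition twofunctor_id (C : twocat) : twofunctor C C :=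
  @TwoFunctor C C (fun x => x) (fun x y => functor_id (hom x y))
    (fun _ => eq_refl) (fun _ _ _ _ _ => eq_refl)
    (fun _ _ _ _ _ _ _ _ _ => arr_eq_refl _).

(** * Isomorphisms of cocones, and cocones over a point *)

(** Inverses chosen at each object are automatically compatible with the structure 2-cells, because
    [m] is. *)
Lemma cocone_mor_invertible (D : marked_twocat) (E : twocat) (G : twofunctor D E)
    (d : E) (r r' : cocone_cat G d) (m : r ~> r') :
  invertible m <-> forall x, invertible ((m : cocone_mor r r') x).
Proof.
split.
{ intros [n [nm mn]] x; exists ((n : cocone_mor r' r) x); split.
  - exact (f_equal (fun k : cocone_mor r r => k x) nm).
  - exact (f_equal (fun k : cocone_mor r' r' => k x) mn). }
intros im.
set (n x := proj1_sig (constructive_indefinite_description _ (im x))).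
assert (nP : forall x, n x ∘ (m : cocone_mor r r') x = idc _ /\
                       (m : cocone_mor r r') x ∘ n x = idc _).
{ intros x; exact (proj2_sig (constructive_indefinite_description _ (im x))). }
assert (nn : forall (x y : D) (f : hom x y),
  n x ∘ coc2 r' f = coc2 r f ∘ (n y |> map1 G f)).
{ intros x y f.
  (* Insert [m y ∘ n y], whiskered by [map1 G f], on the right; naturality of [m] moves [m] to the
     left, where it cancels against [n x]. *)
  rewrite <- (vcomp_1r (n x ∘ coc2 r' f)), <- hcomp_id.
  rewrite <- (proj2 (nP y)), whiskr_vcomp.
  rewrite vcomp_assoc, <- (vcomp_assoc (coc2 r' f)).
  rewrite <- cocm_nat, !(vcomp_assoc ((m : cocone_mor r r') x)).
  now rewrite <- vcomp_assoc, (proj1 (nP x)), vcomp_1l. }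
exists (CoconeMor nn); split; apply cocone_mor_eq; intros x; apply nP.
Qed.

Lemma terminal_coc2 (E : twocat) (G : twofunctor terminal_marked E) (d : E)
    (r : cocone G d) (x y : terminal_marked) (f : hom x y) :
  coc2 r f ~= idc (coc1 r x).
Proof. destruct x, y, f; exact (coc2_id1 r tt). Qed.

(** * From a marked contraction to finality *)

Section ContractionFinal.

Variables (D : marked_twocat) (c : D) (t : contraction c).
Hypothesis mt : marked_contraction t.
Variables (E : twocat) (G : twofunctor D E) (d : E).

(** The cast only rewrites the source [r @ map1 G (ctr1 t y @ f)] as
    [(r @ map1 G (ctr1 t y)) @ map1 G f]. The cocone laws are the laws of the contraction, mapped by
    [G] and whiskered with [r]. *)
Definition extend_cocone (r : hom (G c) d) : cocone G d.
Proof.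
refine (@Cocone D E G d (fun x => r @ map1 G (ctr1 t x))
  (fun x y f => cast_src
    (eq_trans (f_equal (fun h => r @ h) (thom_comp1 G (ctr1 t y) f))
       (eq_sym (comp1_assoc r (map1 G (ctr1 t y)) (map1 G f))))
    (r <| map2 G (ctr2 t f))) _ _ _ _).
- intros x; eapply arr_eq_trans; [apply cast_src_eq|].
  rewrite <- hcomp_id; apply arr_eq_hcomp; [constructor|].
  unfold map1; rewrite <- farr_id; apply arr_eq_farr, ctr2_id1.
- intros x y z g f; eapply arr_eq_trans; [apply cast_src_eq|].
  apply arr_eq_trans with
    (f' := (r <| map2 G (ctr2 t f)) ∘ (r <| map2 G (ctr2 t g |> f))).
  { rewrite <- whiskl_vcomp; rewrite <- map2_vcomp.
    apply arr_eq_hcomp; [constructor | apply arr_eq_farr, ctr2_comp1]. }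
  apply arr_eq_vcomp; [apply arr_eq_sym, cast_src_eq|].
  eapply arr_eq_trans.
  { apply arr_eq_hcomp; [constructor | apply map2_whiskr]. }
  eapply arr_eq_trans; [apply arr_eq_sym, hcomp_assoc|].
  apply arr_eq_hcomp; [apply arr_eq_sym, cast_src_eq | constructor].
- intros x y f g a; apply arr_eq_eq.
  eapply arr_eq_trans; [apply cast_src_eq|].
  rewrite (ctr2_cell t a); rewrite map2_vcomp, whiskl_vcomp.
  apply arr_eq_vcomp; [apply arr_eq_sym, cast_src_eq|].
  eapply arr_eq_trans.
  { apply arr_eq_hcomp; [constructor | apply map2_whiskl]. }
  apply arr_eq_sym, whiskl_assoc.
- intros x y f mf; apply invertible_cast_src, invertible_whiskl, invertible_farr.
  now apply mt.
Defined.

Definition extend_cocone_mor (r r' : hom (G c) d) (m : r ~> r') :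
  cocone_mor (extend_cocone r) (extend_cocone r').
Proof.
exists (fun x => m |> map1 G (ctr1 t x)).
intros x y f; simpl; apply arr_eq_eq.
eapply arr_eq_trans; [apply arr_eq_vcomp; [constructor | apply cast_src_eq]|].
rewrite whisk_exchange.
apply arr_eq_vcomp; [apply arr_eq_sym, cast_src_eq|].
apply arr_eq_sym; eapply arr_eq_trans; [apply whiskr_assoc|].
apply arr_eq_hcomp; [constructor|].
apply arr_eq_id, eq_sym, thom_comp1.
Defined.

Definition extension :
  functor (cocone_cat (D := terminal_marked) (twofunctor_comp G (point c)) d)
    (cocone_cat G d).
Proof.
refine (@Functor (cocone_cat (D := terminal_marked) (twofunctor_comp G (point c)) d)
  (cocone_cat G d)
  (fun r => extend_cocone (coc1 r tt))
  (fun r r' m => extend_cocone_mor ((m : cocone_mor r r') tt)) _ _).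
- intros r; apply cocone_mor_eq; intros x; apply hcomp_id.
- intros r r' r'' n m; apply cocone_mor_eq; intros x; apply whiskr_vcomp.
Defined.

Definition extend_restrict_mor (r : cocone G d) :
  cocone_mor (extend_cocone (coc1 r c)) r.
Proof.
(* Both sides of the naturality square compute [coc2 r (ctr1 t y @ f)]: one by [coc2_cell] at the
   2-cell [ctr2 t f], the other by [coc2_comp1]. *)
exists (fun x => coc2 r (ctr1 t x)).
intros x y f; simpl; apply arr_eq_eq.
apply arr_eq_trans with (f' := coc2 r (ctr1 t y @ f)).
- rewrite (coc2_cell r (ctr2 t f)).
  apply arr_eq_vcomp; [constructor | apply cast_src_eq].
- apply coc2_comp1.
Defined.

Lemma extend_center (r : hom (G c) d) : r = r @ map1 G (ctr1 t c).
Proof.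
rewrite ctr1_center; unfold map1; rewrite thom_id1; symmetry; apply comp1_1r.
Qed.

(** Since the contraction is the identity at its center, extending and then evaluating at [c]
    returns the same 1-cell; the comparison is an identity with its source cast. *)
Definition restrict_extend_mor
    (r : cocone (D := terminal_marked) (twofunctor_comp G (point c)) d) :
  cocone_mor (restrict_cocone (point c) (extend_cocone (coc1 r tt))) r.
Proof.
unshelve eexists.
- intros []; exact (cast_src (extend_center (coc1 r tt)) (idc (coc1 r tt))).
- intros x y f.
  assert (em : forall z : terminal_marked,
    match z as u return
      coc1 (restrict_cocone (point c) (extend_cocone (coc1 r tt))) u ~> coc1 r u
    with
    | tt => cast_src (extend_center (coc1 r tt)) (idc (coc1 r tt))
    end ~= idc (coc1 r z)).
  { intros []; apply cast_src_eq. }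
  apply arr_eq_eq; eapply arr_eq_trans.
  { eapply arr_eq_vcomp_1r, terminal_coc2. }
  apply arr_eq_sym; eapply arr_eq_trans.
  { eapply arr_eq_vcomp_1l, terminal_coc2. }
  destruct x, y, f.
  eapply arr_eq_trans.
  { apply arr_eq_hcomp; [constructor|].
    apply arr_eq_id; exact (thom_id1 (twofunctor_comp G (point c)) tt). }
  apply hcomp_1r.
Defined.

Lemma contraction_restriction_equivalence : is_equivalence (restriction (point c) G d).
Proof.
exists extension; split.
- exists extend_restrict_mor; split.
  + intros r r' m; apply cocone_mor_eq; intros x.
    (* Naturality in the cocone is the compatibility of [m] with the structure 2-cells at the 1-cell
       [ctr1 t x]. *)
    exact (cocm_nat (m : cocone_mor r r') (ctr1 t x)).
  + intros r; apply cocone_mor_invertible; intros x.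
    now apply (coc2_marked r), mt.
- exists restrict_extend_mor; split.
  + intros r r' m; apply cocone_mor_eq; intros []; simpl.
    apply arr_eq_eq; eapply arr_eq_trans.
    { eapply arr_eq_vcomp_1r, cast_src_eq. }
    apply arr_eq_sym; eapply arr_eq_trans.
    { eapply arr_eq_vcomp_1l, cast_src_eq. }
    eapply arr_eq_trans; [|apply hcomp_1r].
    apply arr_eq_hcomp; [constructor|]; apply arr_eq_id.
    unfold map1; rewrite ctr1_center; apply thom_id1.
  + intros r; apply cocone_mor_invertible; intros []; simpl.
    apply invertible_cast_src, invertible_idc.
Qed.

End ContractionFinal.

(** * From a lifted cocone to a marked contraction *)

Section FinalContraction.

Variables (D : marked_twocat) (c : D) (r : cocone (twofunctor_id D) c).
Variables (th : id1 c ~> coc1 r c) (f : forall x : D, hom x c).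
Hypothesis ith : invertible th.
Hypothesis mf : forall x, marked D (f x).
Hypothesis fc : f c = id1 c.

Definition sigma (x : D) : f x ~> coc1 r x :=
  cast_src (comp1_1l (f x)) (coc2 r (f x) ∘ (th |> f x)).

Lemma sigma_invertible (x : D) : invertible (sigma x).
Proof.
apply invertible_cast_src, invertible_vcomp.
- exact (coc2_marked r (mf x)).
- now apply invertible_whiskr.
Qed.

Lemma sigma_center : sigma c ~= th.
Proof.
eapply arr_eq_trans; [apply cast_src_eq|]; rewrite fc.
eapply arr_eq_trans; [eapply arr_eq_vcomp_1l, coc2_id1 | apply hcomp_1r].
Qed.

Definition sigma_inv (x : D) : coc1 r x ~> f x :=
  proj1_sig (constructive_indefinite_description _ (sigma_invertible x)).

Lemma sigma_invl (x : D) : sigma_inv x ∘ sigma x = idc (f x).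
Proof.
exact (proj1 (proj2_sig (constructive_indefinite_description _ (sigma_invertible x)))).
Qed.

Lemma sigma_invr (x : D) : sigma x ∘ sigma_inv x = idc (coc1 r x).
Proof.
exact (proj2 (proj2_sig (constructive_indefinite_description _ (sigma_invertible x)))).
Qed.

(** The first three laws are those of [r] conjugated by [sigma]; the last one depends on the choice
    of [sigma] through [sigma_center]. *)
Definition transported_contraction : contraction c.
Proof.
refine (@Contraction D c f
  (fun x y g => sigma_inv x ∘ (coc2 r g ∘ (sigma y |> g))) _ _ _ fc _).
- intros x; rewrite <- sigma_invl.
  apply arr_eq_vcomp; [constructor|].
  eapply arr_eq_trans; [eapply arr_eq_vcomp_1l, coc2_id1 | apply hcomp_1r].
- intros x y z h g.
  apply arr_eq_trans with (f' :=
    sigma_inv x ∘ ((coc2 r g ∘ (coc2 r h |> g)) ∘ ((sigma z |> h) |> g))).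
  { apply arr_eq_vcomp; [constructor|].
    apply arr_eq_vcomp; [apply coc2_comp1 | apply arr_eq_sym, whiskr_assoc]. }
  apply eq_arr_eq; rewrite !vcomp_assoc; do 2 f_equal.
  change (map1 (twofunctor_id D) g) with g.
  rewrite <- !whiskr_vcomp; f_equal.
  (* The factors [sigma y] and [sigma_inv y] meet in the middle of the composite and cancel. *)
  now rewrite <- !(vcomp_assoc (sigma y)), sigma_invr, !vcomp_1l.
- intros x y g h a; rewrite (coc2_cell r a), !vcomp_assoc; do 2 f_equal.
  symmetry; apply whisk_exchange.
- intros x.
  apply arr_eq_trans with (f' := sigma_inv x ∘ sigma x).
  + apply arr_eq_vcomp; [constructor|].
    apply arr_eq_sym; eapply arr_eq_trans; [apply cast_src_eq|].
    apply arr_eq_vcomp; [constructor|].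
    apply arr_eq_hcomp; [apply arr_eq_sym, sigma_center | constructor].
  + apply eq_arr_eq, sigma_invl.
Defined.

Lemma transported_contraction_marked : marked_contraction transported_contraction.
Proof.
split; [exact mf|]; intros x y g mg; simpl.
apply invertible_vcomp; [eapply invertible_inverse; [apply sigma_invl | apply sigma_invr]|].
apply invertible_vcomp; [exact (coc2_marked r mg)|].
exact (invertible_whiskr g (sigma_invertible y)).
Qed.

End FinalContraction.

(** * Lifting the identity of the center, and the equivalence *)

(** This inverts, on objects, the identification of cocones over a point with 1-cells out of
    [G tt]. *)
Definition point_cocone (E : twocat) (G : twofunctor terminal_marked E) (d : E)
    (r : hom (G tt) d) : cocone G d.
Proof.
assert (e : forall f : hom (tt : terminal_marked) tt, r = r @ map1 G f).
{ intros []; rewrite <- (comp1_1r r) at 1.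
  apply f_equal, eq_sym; exact (thom_id1 G tt). }
unshelve refine (@Cocone terminal_marked E G d
  (fun x => match x with tt => r end) _ _ _ _ _).
- intros [] [] f; exact (cast_src (e f) (idc r)).
- intros []; apply cast_src_eq.
- intros [] [] [] g f.
  eapply arr_eq_trans; [apply cast_src_eq|].
  apply arr_eq_sym; eapply arr_eq_trans.
  { eapply arr_eq_vcomp_1l, cast_src_eq. }
  eapply arr_eq_trans.
  { apply arr_eq_hcomp; [apply cast_src_eq | constructor]. }
  rewrite hcomp_id; apply arr_eq_id, eq_sym, e.
- intros [] [] [] [] []; apply arr_eq_eq, arr_eq_sym; eapply arr_eq_trans.
  { eapply arr_eq_vcomp_1r; unfold map2.
    rewrite (farr_id (thom G tt tt) tt : farr (thom G tt tt) tt = _), hcomp_id.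
    constructor. }
  constructor.
- intros [] [] f _; apply invertible_cast_src, invertible_idc.
Defined.

Lemma marked_contraction_iff_final (D : marked_twocat) (c : D) :
  (exists t : contraction c, marked_contraction t) <->
  ((forall x : D, exists f : hom x c, marked D f) /\ final (point c)).
Proof.
split.
- intros [t mt]; split.
  + intros x; exists (ctr1 t x); apply mt.
  + intros E G d; exact (contraction_restriction_equivalence mt G d).
- intros [mD fin].
  destruct (fin D (twofunctor_id D) c) as [K [_ [eta [_ ieta]]]].
  set (s := point_cocone (G := twofunctor_comp (twofunctor_id D) (point c))
              (id1 c : hom ((twofunctor_comp (twofunctor_id D) (point c)) tt) c)).
  (* The component [eta s] goes from the restriction of [K s] to [s]; its inverse [th], evaluated at
     the point, is the required 2-cell from [id1 c] to [coc1 (K s) c]. *)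
  destruct (ieta s) as [th [tl tr]].
  assert (ith : invertible ((th : cocone_mor _ _) tt)).
  { apply (proj1 (cocone_mor_invertible th)).
    exact (ex_intro _ (eta s) (conj tr tl)). }
  (* The condition at the center is stated for every [x] by transport along [c = x], so that one
     choice of 1-cells also satisfies [f c = id1 c]. Deciding [c = x] is classical. *)
  assert (fs : forall x : D, exists g : hom x c, marked D g /\
    forall e : c = x, g = match e in _ = z return hom z c with eq_refl => id1 c end).
  { intros x; destruct (classic (c = x)) as [e | ne].
    - subst x; exists (id1 c); split; [apply marked_id1|].
      intros e; now rewrite (proof_irrelevance _ e eq_refl).
    - destruct (mD x) as [g mg]; exists g; split; [exact mg|].
      intros e; now destruct ne. }
  set (f x := proj1_sig (constructive_indefinite_description _ (fs x))).
  assert (fP := fun x => proj2_sig (constructive_indefinite_description _ (fs x))).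
  exists (transported_contraction (r := K s) (f := f) ith (fun x => proj1 (fP x))
            (proj2 (fP c) eq_refl)).
  apply transported_contraction_marked.
Qed.

Theorem proposition4p6 (J : marked_twocat) (C : twocat) (F : twofunctor J C)
    (l : cone_twocat F) :
  (exists t : contraction l, limiting_contraction t) <->
  ((forall l' : cone_twocat F,
      exists f : hom l' l, cartesian (cone_proj F) f) /\
   final (point (D := cone_cart F) l)).
Proof. exact (marked_contraction_iff_final (D := cone_cart F) l). Qed.
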